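(* Let $I\subset\mathbb{R}$ be an open interval. (Uniqueness) Let $\gamma_1,\gamma_2:I\to H^1$ be two horizontally regular curves parametrized by horizontal arc-length $s$. Suppose that they have the same $p$-curvature $k(s)$ and the same $T$-variation $\tau(s)$. Then there exists $g\in PSH(1)$ such that $\gamma_2(s)=g\circ\gamma_1(s)$ for all $s\in I$. (Existence) Given smooth functions $k,\tau:I\to\mathbb{R}$, there exists a horizontally regular curve $\gamma:I\to H^1$, parametrized by horizontal arc-length, whose $p$-curvature is $k(s)$ and whose $T$-variation is $\tau(s)$.
   Context: $H^1$ is $\mathbb{R}^3$ with group law $(x_1,y_1,z_1)\circ(x_2,y_2,z_2)=(x_1+x_2,\,y_1+y_2,\,z_1+z_2+y_1x_2-x_1y_2)$ and left invariant vector fields $\mathring e_1=\partial_x+y\,\partial_z$, $\mathring e_2=\partial_y-x\,\partial_z$, $T=\partial_z$. The contact form is $\theta_0=dz+x\,dy-y\,dx$, the contact bundle is $\xi_0=\ker\theta_0=\mathrm{span}(\mathring e_1,\mathring e_2)$, and $J_0:\xi_0\to\xi_0$ is given by $J_0\mathring e_1=\mathring e_2$, $J_0\mathring e_2=-\mathring e_1$. $\langle\cdot,\cdot\rangle$ is the Riemannian metric on $H^1$ for which $\mathring e_1,\mathring e_2,T$ are orthonormal, and $|\cdot|$ its norm. $PSH(1)$ is the group of pseudohermitian transformations (Heisenberg rigid motions): diffeomorphisms $\Phi$ of $H^1$ with $\Phi^*\theta_0=\theta_0$ and $\Phi_*J_0=J_0\Phi_*$ on $\xi_0$. All curves are smooth.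 For a parametrized curve $\gamma$, write $\gamma'=\gamma'_{\xi_0}+\gamma'_T$ with $\gamma'_{\xi_0}\in\xi_0$ and $\gamma'_T$ a multiple of $T$. The curve is horizontally regular if $\gamma'_{\xi_0}(t)\neq0$ for every $t$; it is parametrized by horizontal arc-length $s$ if $|\gamma'_{\xi_0}(s)|=1$ for all $s$. In that case put $X(s)=\gamma'_{\xi_0}(s)$, $Y(s)=J_0X(s)$; the $p$-curvature is $k(s)=\langle \frac{dX}{ds}(s),Y(s)\rangle$ and the $T$-variation is $\tau(s)=\langle\gamma'(s),T\rangle$. Here $\frac{dX}{ds}$ is the componentwise derivative of $X$ viewed as an $\mathbb{R}^3$-valued function (components with respect to $\partial_x,\partial_y,\partial_z$), regarded as a tangent vector at $\gamma(s)$. *)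

(* Defs.v *)
From HB Require Import structures.
From mathcomp Require Import all_boot all_order all_algebra.
From mathcomp Require Import all_classical all_reals all_analysis.
From mathcomp Require Import ring.
Set Implicit Arguments.
Unset Strict Implicit.
Unset Printing Implicit Defensive.
Import Order.TTheory GRing.Theory Num.Theory.
Import numFieldNormedType.Exports.
Local Open Scope classical_set_scope.
Local Open Scope ring_scope.

(* C^n maps on an open set A.  Only used for open A: values outside A
   then play no role, since all limits are taken at points of A. *)
Fixpoint Cn_on (R : realType) (V W : normedModType R) (A : set V) (n : nat)
    (f : V -> W) : Prop :=
  if n is m.+1 then
    forall v : V, (forall x, A x -> derivable f x v) /\
                  Cn_on A m (fun x => 'D_v f x)
  else forall x, A x -> {for x, continuous f}.

Definition smooth_on (R : realType) (V W : normedModType R) (A : set V)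
    (f : V -> W) : Prop := forall n, Cn_on A n f.

Definition diffeomorphism (R : realType) (V W : normedModType R)
    (f : V -> W) : Prop :=
  smooth_on setT f /\
  exists g : W -> V, [/\ smooth_on setT g, cancel f g & cancel g f].

Section Heisenberg.
Variable R : realType.

(* Points of H^1, and tangent vectors at any point written in the basis
   (d/dx, d/dy, d/dz), are both row vectors of length 3. *)
Definition vec3 (a b c : R) : 'rV[R]_3 := \row_j nth 0 [:: a; b; c] j.
Definition cx (v : 'rV[R]_3) : R := v ord0 (inord 0).
Definition cy (v : 'rV[R]_3) : R := v ord0 (inord 1).
Definition cz (v : 'rV[R]_3) : R := v ord0 (inord 2).

Definition e1 (p : 'rV[R]_3) : 'rV[R]_3 := vec3 1 0 (cy p).
Definition e2 (p : 'rV[R]_3) : 'rV[R]_3 := vec3 0 1 (- cx p).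
Definition eT : 'rV[R]_3 := vec3 0 0 1.

Definition theta0 (p v : 'rV[R]_3) : R := cz v + cx p * cy v - cy p * cx v.

Definition xi0 (p : 'rV[R]_3) : set 'rV[R]_3 := [set v | theta0 p v = 0].

(* Only meaningful on xi0 p, where v = cx v *: e1 p + cy v *: e2 p. *)
Definition J0 (p v : 'rV[R]_3) : 'rV[R]_3 := cx v *: e2 p - cy v *: e1 p.

(* By [frame_decomposition] below, (cx v, cy v, theta0 p v) are the
   coordinates of v in the frame (e1, e2, T) at p, so this is the metric
   making that frame orthonormal. *)
Definition metric (p v w : 'rV[R]_3) : R :=
  cx v * cx w + cy v * cy w + theta0 p v * theta0 p w.
Definition mnorm (p v : 'rV[R]_3) : R := Num.sqrt (metric p v v).

Definition Tpart (p v : 'rV[R]_3) : 'rV[R]_3 := theta0 p v *: eT.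
Definition hpart (p v : 'rV[R]_3) : 'rV[R]_3 := v - Tpart p v.

Definition PSH (Phi : 'rV[R]_3 -> 'rV[R]_3) : Prop :=
  [/\ diffeomorphism Phi,
      forall p v, theta0 (Phi p) ('d Phi p v) = theta0 p v &
      forall p v, xi0 p v -> 'd Phi p (J0 p v) = J0 (Phi p) ('d Phi p v)].

Definition hvelocity (gamma : R -> 'rV[R]_3) (s : R) : 'rV[R]_3 :=
  hpart (gamma s) (gamma^`()%classic s).

Definition horizontally_regular (I : set R) (gamma : R -> 'rV[R]_3) : Prop :=
  forall t, I t -> hvelocity gamma t != 0.

Definition horizontal_arclength (I : set R) (gamma : R -> 'rV[R]_3) : Prop :=
  forall s, I s -> mnorm (gamma s) (hvelocity gamma s) = 1.

Definition pcurvature (gamma : R -> 'rV[R]_3) (s : R) : R :=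
  metric (gamma s) ((hvelocity gamma)^`()%classic s)
         (J0 (gamma s) (hvelocity gamma s)).

Definition Tvariation (gamma : R -> 'rV[R]_3) (s : R) : R :=
  metric (gamma s) (gamma^`()%classic s) eT.

Lemma cxE a b c : cx (vec3 a b c) = a.
Proof. by rewrite /cx mxE inordK. Qed.
Lemma cyE a b c : cy (vec3 a b c) = b.
Proof. by rewrite /cy mxE inordK. Qed.
Lemma czE a b c : cz (vec3 a b c) = c.
Proof. by rewrite /cz mxE inordK. Qed.
Definition cE := (cxE, cyE, czE).

Lemma vec3_eta v : v = vec3 (cx v) (cy v) (cz v).
Proof.
apply/rowP => i; rewrite mxE /cx /cy /cz; case: i => -[|[|[|//]]] Hi /=;
  by congr (v _ _); apply/val_inj; rewrite /= inordK.
Qed.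

Lemma frame_decomposition p v :
  v = cx v *: e1 p + cy v *: e2 p + theta0 p v *: eT.
Proof.
rewrite {1}(vec3_eta v); apply/rowP => i; rewrite !mxE /theta0.
by case: i => -[|[|[|//]]] Hi /=; ring.
Qed.

Lemma frame_orthonormal p :
  [/\ metric p (e1 p) (e1 p) = 1, metric p (e2 p) (e2 p) = 1 &
      metric p eT eT = 1] /\
  [/\ metric p (e1 p) (e2 p) = 0, metric p (e1 p) eT = 0 &
      metric p (e2 p) eT = 0].
Proof.
by rewrite /metric /theta0 /e1 /e2 /eT !cE; split; split; ring.
Qed.

Lemma J0_frame p : J0 p (e1 p) = e2 p /\ J0 p (e2 p) = - e1 p.
Proof. by rewrite /J0 /e1 /e2 !cE !(scale1r, scale0r) subr0 sub0r. Qed.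

Lemma hpart_xi0 p v : xi0 p (hpart p v).
Proof.
rewrite /xi0 /= /hpart /Tpart {1}/theta0 /cx /cy /cz !mxE !inordK //=.
by rewrite /theta0 /cx /cy /cz; ring.
Qed.

End Heisenberg.

(* Main.v *)
(* In the plane coordinates the p-curvature is the signed curvature of the
   projected curve and the T-variation prescribes z' once (x, y) is known.
   Uniqueness: the velocities of the projections satisfy the same linear
   Frenet equation, so the cosine and sine of the angle between them are
   constant; the second projection is thus a rotated translate of the first, and
   the z-coordinates then differ by exactly what the left translation accounts
   for.  Existence: integrate k to an angle theta, (cos theta, sin theta) to
   (x, y), and tau + y x' - x y' to z. *)
Require Import Defs.
From HB Require Import structures.
From mathcomp Require Import all_boot all_order all_algebra.
From mathcomp Require Import all_classical all_reals all_analysis.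
From mathcomp Require Import ring lra.
Set Implicit Arguments.
Unset Strict Implicit.
Unset Printing Implicit Defensive.
Import Order.TTheory GRing.Theory Num.Theory.
Import numFieldNormedType.Exports.
Local Open Scope classical_set_scope.
Local Open Scope ring_scope.

(** * Calculus of C^n maps on an open set *)

Lemma Cn_onS (R : realType) (V W : normedModType R) (A : set V) (n : nat)
    (f : V -> W) (v : V) : Cn_on A n.+1 f ->
  (forall x, A x -> derivable f x v) /\ Cn_on A n ('D_v f).
Proof. by move=> /(_ v). Qed.

(** Derivatives see only germs, and openness makes the equality on [A] hold near each of its points.
    The closure rules below rely on this: their derivative formulas are known only on [A]. *)
Lemma Cn_on_ext (R : realType) (V W : normedModType R) (A : set V) (n : nat)
    (f g : V -> W) :
  open A -> (forall x, A x -> f x = g x) -> Cn_on A n f -> Cn_on A n g.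
Proof.
move=> oA; elim: n f g => [|n IHn] f g fg /=.
  move=> fc x Ax; have : f @ x --> g x by rewrite -fg//; exact: fc.
  apply: cvg_trans; apply: near_eq_cvg.
  by apply: filterS (open_nbhs_nbhs (conj oA Ax)) => y /fg.
have near_fg x : A x -> \forall y \near x, f y = g y.
  by move=> Ax; apply: filterS (open_nbhs_nbhs (conj oA Ax)) => y /fg.
move=> fn v; have [df Dfn] := fn v; split=> [x Ax|].
  exact: near_eq_derivable (near_fg _ Ax) (df x Ax).
by apply: IHn Dfn => x Ax; exact/near_eq_derive/near_fg.
Qed.

Lemma Cn_on_cst (R : realType) (V W : normedModType R) (A : set V) (n : nat)
    (c : W) : Cn_on A n (fun=> c).
Proof.
elim: n c => [|n IHn] c /=; first by move=> x _; exact: cvg_cst.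
move=> v; split=> [x _|]; first exact: derivable_cst.
have -> // : (fun x => 'D_v (cst c) x) = fun=> 0 :> W.
by apply/funext => x; exact: derive_cst.
Qed.

(** * Smoothness for functions of one real variable *)

Section curves.
Context {R : realType}.
Implicit Types (A : set R).

Lemma derivable_cvg (W : normedModType R) (f : R -> W) (x : R) :
  derivable f x 1 -> {for x, continuous f}.
Proof. by move=> /derivable1_diffP; exact: differentiable_continuous. Qed.

Lemma derivable_dir (W : normedModType R) (f : R -> W) (x v : R) :
  derivable f x 1 -> derivable f x v.
Proof. by move=> /derivable1_diffP; exact: diff_derivable. Qed.

(** [Cn_on] quantifies over all directions; on the line the differential is linear, so direction 1
    determines the others. *)
Lemma is_derive_dir (W : normedModType R) (f : R -> W) (x v : R) (df : W) :
  is_derive x 1 f df -> 'D_v f x = v *: df.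
Proof.
move=> [/derivable1_diffP dfx <-]; rewrite !deriveE//.
by rewrite -{1}(mulr1 v) -[v * 1]/(v *: (1 : R)) linearZ.
Qed.

Lemma is_derive_locally_cst A (f : R -> R) (c x df : R) : open A -> A x ->
  (forall t, A t -> f t = c) -> is_derive x 1 f df -> df = 0.
Proof.
move=> oA Ax fc [_ <-].
have -> : 'D_1 f x = 'D_1 (cst c) x.
  apply: near_eq_derive.
  by apply: filterS (open_nbhs_nbhs (conj oA Ax)) => y /fc.
exact: derive_cst.
Qed.

Lemma Cn_on_pred (W : normedModType R) A n (f : R -> W) :
  Cn_on A n.+1 f -> Cn_on A n f.
Proof.
elim: n f => [|n IHn] f /= fn; last first.
  by move=> v; have [df Dfn] := fn v; split=> //; exact: IHn.
by move=> x Ax; apply: derivable_cvg; have [df _] := fn 1; exact: df.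
Qed.

Lemma Cn_onD A n (f g : R -> R) : open A ->
  Cn_on A n f -> Cn_on A n g -> Cn_on A n (fun x => f x + g x).
Proof.
move=> oA; elim: n f g => [|n IHn] f g /=.
  by move=> fc gc x Ax; apply: cvgD; [exact: fc|exact: gc].
move=> fn gn v; have [df Df] := Cn_onS v fn; have [dg Dg] := Cn_onS v gn.
split=> [x Ax|].
  by apply: derivableD; [exact: df|exact: dg].
apply: Cn_on_ext (IHn _ _ Df Dg) => // x Ax.
by rewrite deriveD//; [exact: df|exact: dg].
Qed.

Lemma Cn_onM A n (f g : R -> R) : open A ->
  Cn_on A n f -> Cn_on A n g -> Cn_on A n (fun x => f x * g x).
Proof.
move=> oA; elim: n f g => [|n IHn] f g.
  by move=> /= fc gc x Ax; apply: cvgM; [exact: fc|exact: gc].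
move=> fn gn v; have [df Df] := Cn_onS v fn; have [dg Dg] := Cn_onS v gn.
split=> [x Ax|].
  by apply: derivableM; [exact: df|exact: dg].
(* The Leibniz rule keeps one factor undifferentiated, so [f] and [g] are first lowered to order
   [n]. *)
apply: Cn_on_ext (Cn_onD oA (IHn _ _ (Cn_on_pred fn) Dg)
                           (IHn _ _ (Cn_on_pred gn) Df)) => // x Ax.
by rewrite deriveM//; [exact: df|exact: dg].
Qed.

Lemma Cn_onN A n (f : R -> R) : open A ->
  Cn_on A n f -> Cn_on A n (fun x => - f x).
Proof.
move=> oA fn; apply: Cn_on_ext (Cn_onM oA (@Cn_on_cst _ _ _ A n (-1 : R)) fn) => //.
by move=> x _; rewrite mulN1r.
Qed.

Lemma smooth_derivable (W : normedModType R) A (f : R -> W) x :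
  smooth_on A f -> A x -> derivable f x 1.
Proof. by move=> /(_ 1%N) /(_ 1)[+ _]; apply. Qed.

Lemma smooth_derive1 (W : normedModType R) A (f : R -> W) :
  smooth_on A f -> smooth_on A f^`()%classic.
Proof.
move=> fs n; rewrite (_ : f^`()%classic = 'D_1 f); last exact/funext/derive1E.
by have /(_ 1)[_] := fs n.+1.
Qed.

(** No induction: on [A] the derivative of [F] along [v] is [v * f], so order [n] for [f] gives
    order [n.+1] for [F]. *)
Lemma smooth_primitive A (F f : R -> R) : open A ->
  (forall x, A x -> is_derive x 1 F (f x)) -> smooth_on A f -> smooth_on A F.
Proof.
move=> oA dF fs; have dF1 x : A x -> derivable F x 1 by case/dF.
case=> [x /dF1|n v]; first exact: derivable_cvg.
split=> [x /dF1|]; first exact: derivable_dir.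
apply: Cn_on_ext (Cn_onM oA (@Cn_on_cst _ _ _ A n (v : R)) (fs n)) => // x Ax.
exact/esym/(is_derive_dir _ (dF x Ax)).
Qed.

Lemma smooth_trigo A (f : R -> R) : open A -> smooth_on A f ->
  smooth_on A (fun x => cos (f x)) /\ smooth_on A (fun x => sin (f x)).
Proof.
move=> oA fs.
have dcos x : A x -> is_derive x 1 (fun x => cos (f x)) (- sin (f x) * f^`()%classic x).
  move=> Ax; have /derivableP := smooth_derivable fs Ax.
  by rewrite -derive1E => df; exact: (is_derive1_comp (f := cos)).
have dsin x : A x -> is_derive x 1 (fun x => sin (f x)) (cos (f x) * f^`()%classic x).
  move=> Ax; have /derivableP := smooth_derivable fs Ax.
  by rewrite -derive1E => df; exact: (is_derive1_comp (f := sin)).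
(* Sine and cosine go through the induction together, since each appears in the derivative of the
   other. *)
suff H n : Cn_on A n (fun x => cos (f x)) /\ Cn_on A n (fun x => sin (f x)).
  by split=> n; have [] := H n.
have dcos1 x : A x -> derivable (fun x => cos (f x)) x 1 by case/dcos.
have dsin1 x : A x -> derivable (fun x => sin (f x)) x 1 by case/dsin.
have f's := smooth_derive1 fs.
elim: n => [|n [IHc IHs]].
  by split=> [x /dcos1|x /dsin1]; exact: derivable_cvg.
have vs (v : R) : Cn_on A n (fun x => v * f^`()%classic x).
  exact: Cn_onM oA (@Cn_on_cst _ _ _ A n (v : R)) (f's n).
split=> v; split.
- by move=> x Ax; apply/derivable_dir/dcos1.
- apply: Cn_on_ext (Cn_onM oA (Cn_onN oA IHs) (vs v)) => // x Ax.
  by rewrite mulrCA; exact/esym/(is_derive_dir _ (dcos x Ax)).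
- by move=> x Ax; apply/derivable_dir/dsin1.
- apply: Cn_on_ext (Cn_onM oA IHc (vs v)) => // x Ax.
  by rewrite mulrCA; exact/esym/(is_derive_dir _ (dsin x Ax)).
Qed.

(* The induction trades one derivative of the components for the continuity
   of [f], so that only componentwise differentiability is ever needed. *)
Lemma smooth_rV A m (f : R -> 'rV[R]_m) : open A ->
  (forall j, smooth_on A (fun x => f x ord0 j)) -> smooth_on A f.
Proof.
move=> oA fs n.
suff {fs} : (forall j, Cn_on A n.+1 (fun x => f x ord0 j)) -> Cn_on A n f.
  by apply=> j; exact: fs.
elim: n f => [|n IHn] f fn.
  move=> x Ax; apply/derivable_cvg/derivable_mxP => i j; rewrite ord1.
  by have [df _] := fn j 1; exact: df.
move=> v.
have df x : A x -> derivable f x v.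
  move=> Ax; apply/derivable_mxP => i j; rewrite ord1.
  by have [+ _] := fn j v; exact.
split=> //; apply: IHn => j.
have [_] := Cn_onS v (fn j); apply: Cn_on_ext => // x Ax.
by rewrite derive_mx ?mxE//; exact: df.
Qed.

Lemma is_derive_coord m (f : R -> 'rV[R]_m) j x : derivable f x 1 ->
  is_derive x 1 (fun t => f t ord0 j) (f^`()%classic x ord0 j).
Proof.
move=> df; rewrite derive1E derive_mx// mxE; apply: derivableP.
by move/derivable_mxP: df; exact.
Qed.

(** * Constancy and primitives on an interval *)

Lemma is_derive_eq0_itv (I : set R) (f : R -> R) : is_interval I ->
  (forall x, I x -> is_derive x 1 f 0) ->
  forall x y, I x -> I y -> f x = f y.
Proof.
move=> Iitv df x y; wlog xy : x y / x <= y.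
  by move=> H Ix Iy; case/orP: (le_total x y) => xy; [|symmetry]; exact: H.
move=> Ix Iy; have II z : z \in `[x, y] -> I z.
  by rewrite in_itv/= => xzy; exact: (Iitv _ _ Ix Iy _ xzy).
have [z zxy||c _] := @MVT_segment R f (fun=> 0) x y xy.
- by apply: df; apply: II; apply: subset_itv_oo_cc zxy.
- apply: derivable_within_continuous => z /II Iz; by case: (df z Iz).
- by rewrite mul0r => /eqP; rewrite subr_eq0 => /eqP.
Qed.

(** Supplies a segment inside [I] with both the base point and the current point in its interior, on
    which the fundamental theorem of calculus applies. *)
Lemma open_itv_nbhs (I : set R) x y : open I -> is_interval I -> I x -> I y ->
  exists a b, [/\ I a, I b, a < x < b & a < y < b].
Proof.
move=> oI Iitv Ix Iy.
have ext z : I z -> exists2 e, 0 < e & I (z - e) /\ I (z + e).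
  move=> Iz; have /nbhs_ballP[e /= e0 He] := open_nbhs_nbhs (conj oI Iz).
  have e2 : 0 < e / 2 by rewrite divr_gt0.
  exists (e / 2) => //; split; apply: He; rewrite /ball/=.
    by rewrite opprB addrC subrK gtr0_norm// ltr_pdivrMr// mulr_natr mulr2n ltrDl.
  by rewrite opprD addNKr normrN gtr0_norm// ltr_pdivrMr// mulr_natr mulr2n ltrDl.
have [ex ex0 [Ixl Ixr]] := ext x Ix; have [ey ey0 [Iyl Iyr]] := ext y Iy.
exists (Num.min (x - ex) (y - ey)), (Num.max (x + ex) (y + ey)); split.
- by case: ltP.
- by case: ltP.
- by rewrite gt_min lt_max; apply/andP; split; apply/orP; left; lra.
- by rewrite gt_min lt_max; apply/andP; split; apply/orP; right; lra.
Qed.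

(* The signed integral of [f] from [s0] to [x]: one of the two intervals is
   empty. *)
Definition primitive (s0 : R) (f : R -> R) (x : R) : R :=
  \int[lebesgue_measure]_(t in `]s0, x]) f t -
  \int[lebesgue_measure]_(t in `]x, s0]) f t.

(** With [a] to the left of both [s0] and [x], the signed integral equals [F y - F s0] for [y] near
    [x], where [F] integrates from [a]. This holds on either side of [s0], so the fundamental
    theorem for [F] suffices. *)
Lemma is_derive_primitive (I : set R) (s0 : R) (f : R -> R) :
  open I -> is_interval I -> I s0 -> (forall x, I x -> {for x, continuous f}) ->
  forall x, I x -> is_derive x 1 (primitive s0 f) (f x).
Proof.
move=> oI Iitv Is0 fc x Ix.
have [a [b [Ia Ib /andP[ax xb] /andP[as0 s0b]]]] := open_itv_nbhs oI Iitv Ix Is0.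
have fi : lebesgue_measure.-integrable `[a, b] (EFin \o f).
  apply: continuous_compact_integrable; first exact: segment_compact.
  apply: continuous_in_subspaceT => z; rewrite inE/= in_itv/= => azb.
  exact/fc/(Iitv _ _ Ia Ib _ azb).
have [dF F'] := continuous_FTC1_closed xb fi ax (fc x Ix).
set F := fun y : R => \int[lebesgue_measure]_(t in `[a, y]) f t.
have {}dF : is_derive x 1 (fun y => F y - F s0) (f x).
  rewrite -[f x]subr0; apply: is_deriveB.
  by split=> //; rewrite -derive1E.
apply: near_eq_is_derive dF.
have fiS c : c < b -> lebesgue_measure.-integrable `[a, c] (EFin \o f).
  move=> cb; apply: integrableS fi => //; apply: subset_itvl.
  by rewrite bnd_simp ltW.
near=> y.
have ay : a < y by near: y; exact: lt_nbhsr.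
have yb : y < b by near: y; exact: lt_nbhsl.
rewrite /primitive; case: (leP s0 y) => s0y.
  rewrite (@set_itv_ge _ _ (BRight y)) ?bnd_simp -?leNgt// Rintegral_set0 subr0.
  by rewrite /F Rintegral_itvB ?bnd_simp//; [exact: fiS|exact: ltW].
rewrite (@set_itv_ge _ _ (BRight s0)) ?bnd_simp -?leNgt ?ltW// Rintegral_set0 sub0r.
rewrite /F -(@Rintegral_itvB _ f (BLeft a) (BRight s0) y) ?bnd_simp ?opprB//;
  [exact: fiS|exact: ltW..].
Unshelve. all: by end_near. Qed.

End curves.

(** * Coordinates, horizontal velocity and p-curvature *)

Section heisenberg.
Context {R : realType}.
Implicit Types (I : set R) (gamma : R -> 'rV[R]_3).

Lemma cx_is_linear : linear (@cx R).
Proof. by move=> a u v; rewrite /cx !mxE. Qed.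
Lemma cy_is_linear : linear (@cy R).
Proof. by move=> a u v; rewrite /cy !mxE. Qed.
Lemma cz_is_linear : linear (@cz R).
Proof. by move=> a u v; rewrite /cz !mxE. Qed.
HB.instance Definition _ := GRing.isLinear.Build _ _ _ _ (@cx R) cx_is_linear.
HB.instance Definition _ := GRing.isLinear.Build _ _ _ _ (@cy R) cy_is_linear.
HB.instance Definition _ := GRing.isLinear.Build _ _ _ _ (@cz R) cz_is_linear.

Lemma coordD (u v : 'rV[R]_3) :
  (cx (u + v) = cx u + cx v) * (cy (u + v) = cy u + cy v) *
  (cz (u + v) = cz u + cz v).
Proof. by rewrite /cx /cy /cz !mxE. Qed.

Lemma coordN (u : 'rV[R]_3) :
  (cx (- u) = - cx u) * (cy (- u) = - cy u) * (cz (- u) = - cz u).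
Proof. by rewrite /cx /cy /cz !mxE. Qed.

Lemma coordZ (a : R) (u : 'rV[R]_3) :
  (cx (a *: u) = a * cx u) * (cy (a *: u) = a * cy u) *
  (cz (a *: u) = a * cz u).
Proof. by rewrite /cx /cy /cz !mxE. Qed.

Definition coordE := (coordD, coordN, coordZ, (@cxE R, @cyE R, @czE R)).

Lemma coordP (v w : 'rV[R]_3) :
  cx v = cx w -> cy v = cy w -> cz v = cz w -> v = w.
Proof. by rewrite (vec3_eta v) (vec3_eta w) !cE => -> -> ->. Qed.

(** Turns a componentwise claim about a [vec3]-valued curve into three scalar claims. *)
Lemma vec3_coord_ind (P : 'I_3 -> (R -> R) -> Prop) (f g h : R -> R) :
  P (inord 0) f -> P (inord 1) g -> P (inord 2) h ->
  forall j, P j (fun t => vec3 (f t) (g t) (h t) ord0 j).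
Proof.
move=> Pf Pg Ph j.
have -> : (fun t => vec3 (f t) (g t) (h t) ord0 j) = nth (fun=> 0) [:: f; g; h] j.
  by apply/funext => t; rewrite mxE; case: j => -[|[|[|//]]] lj.
have := ltn_ord j; rewrite -[in P j](inord_val j).
by move: (val j) => [|[|[|]]].
Qed.

Lemma is_derive_vec3 (f g h : R -> R) (s f' g' h' : R) :
  is_derive s 1 f f' -> is_derive s 1 g g' -> is_derive s 1 h h' ->
  is_derive s 1 (fun t => vec3 (f t) (g t) (h t)) (vec3 f' g' h').
Proof.
move=> df dg dh.
have dj : forall j, is_derive s 1 (fun t => vec3 (f t) (g t) (h t) ord0 j)
                              (vec3 f' g' h' ord0 j).
  apply: (vec3_coord_ind (P := fun j F => is_derive s 1 F (vec3 f' g' h' ord0 j)));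
    by rewrite -?/(cx _) -?/(cy _) -?/(cz _) cE.
have dv : derivable (fun t => vec3 (f t) (g t) (h t)) s 1.
  by apply/derivable_mxP => i j; rewrite ord1; case: (dj j).
split=> //; rewrite derive_mx//; apply/rowP => j; rewrite mxE.
by case: (dj j).
Qed.

Lemma smooth_vec3 I (f g h : R -> R) : open I ->
  smooth_on I f -> smooth_on I g -> smooth_on I h ->
  smooth_on I (fun t => vec3 (f t) (g t) (h t)).
Proof.
move=> oI fs gs hs; apply: smooth_rV => //.
exact: (vec3_coord_ind (P := fun=> smooth_on I)).
Qed.

Lemma metric_eT (p v : 'rV[R]_3) : metric p v (eT R) = theta0 p v.
Proof. by rewrite /metric /theta0 /eT !cE; ring. Qed.

Lemma mnorm_hpart (p v : 'rV[R]_3) :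
  mnorm p (hpart p v) = Num.sqrt (cx v ^+ 2 + cy v ^+ 2).
Proof.
rewrite /mnorm /metric (hpart_xi0 p v) /hpart /Tpart /eT !coordE.
by congr Num.sqrt; ring.
Qed.

(** The derivative of the T-coefficient is left unevaluated: it multiplies [eT], which has no planar
    components. *)
Lemma is_derive_hvelocity I gamma s : smooth_on I gamma -> I s ->
  is_derive s 1 (hvelocity gamma) (gamma^`()^`()%classic s -
    (fun t => theta0 (gamma t) (gamma^`()%classic t))^`()%classic s *: eT R).
Proof.
move=> gs Is.
have dg := smooth_derivable gs Is.
have dg' := smooth_derivable (smooth_derive1 gs) Is.
have dth : derivable (fun t => theta0 (gamma t) (gamma^`()%classic t) : R) s 1.
  have dgj j := is_derive_coord j dg; have dg'j j := is_derive_coord j dg'.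
  rewrite /theta0 /cx /cy /cz.
  by apply: derivableB; [apply: derivableD|apply: derivableM].
have dv : is_derive s 1 gamma^`()%classic (gamma^`()^`()%classic s).
  by rewrite [X in is_derive _ _ _ X]derive1E; exact: derivableP.
set th := (fun t => _) in dth *.
have dT : is_derive s 1 (fun t => th t *: eT R) (th^`()%classic s *: eT R).
  move/derivable1_diffP: dth => dth.
  have dZ := differentiableZl (eT R) dth.
  apply: DeriveDef; first exact/derivable1_diffP.
  by rewrite deriveE// diffZl// derive1E deriveE.
exact: is_deriveB dv dT.
Qed.

(** [J0] lands in the contact plane, so the [theta0] term of the metric vanishes and only planar
    components remain. *)
Lemma pcurvatureE I gamma s : smooth_on I gamma -> I s ->
  pcurvature gamma s = cx (gamma^`()%classic s) * cy (gamma^`()^`()%classic s)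
                     - cy (gamma^`()%classic s) * cx (gamma^`()^`()%classic s).
Proof.
move=> gs Is; rewrite /pcurvature derive1E.
have [_ ->] := is_derive_hvelocity gs Is.
rewrite /metric /hvelocity [X in _ + _ * X](_ : _ = 0).
  by rewrite /J0 /hpart /Tpart /e1 /e2 /eT !coordE; ring.
by rewrite /theta0 /J0 /e1 /e2 !coordE; ring.
Qed.

(** * Frenet equations of the projected curve *)

Section unit_speed.
Variables (I : set R) (gamma : R -> 'rV[R]_3).
Hypotheses (oI : open I) (gs : smooth_on I gamma).
Hypothesis arc : horizontal_arclength I gamma.

Lemma arclength_unit s : I s ->
  cx (gamma^`()%classic s) ^+ 2 + cy (gamma^`()%classic s) ^+ 2 = 1.
Proof.
move=> /arc; rewrite mnorm_hpart => h.
by rewrite -[LHS]sqr_sqrtr ?h ?expr1n// addr_ge0// sqr_ge0.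
Qed.

Lemma is_derive_curve s : I s ->
  [/\ is_derive s 1 (fun t => cx (gamma t)) (cx (gamma^`()%classic s)),
      is_derive s 1 (fun t => cy (gamma t)) (cy (gamma^`()%classic s)) &
      is_derive s 1 (fun t => cz (gamma t)) (cz (gamma^`()%classic s))].
Proof.
by move=> Is; have dg := smooth_derivable gs Is; split; exact: is_derive_coord.
Qed.

(** Differentiating the unit speed identity makes the planar acceleration orthogonal to the
    velocity, hence a multiple of the velocity turned by a right angle; by [pcurvatureE] the factor
    is the p-curvature. *)
Lemma is_derive_velocity s : I s ->
  is_derive s 1 (fun t => cx (gamma^`()%classic t))
    (- (pcurvature gamma s * cy (gamma^`()%classic s))) /\
  is_derive s 1 (fun t => cy (gamma^`()%classic t))
    (pcurvature gamma s * cx (gamma^`()%classic s)).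
Proof.
move=> Is; rewrite (pcurvatureE gs Is).
have dg' := smooth_derivable (smooth_derive1 gs) Is.
have := is_derive_coord (inord 0) dg'; have := is_derive_coord (inord 1) dg'.
rewrite -/(cx _) -/(cy _).
set x' := cx (gamma^`()%classic s); set y' := cy (gamma^`()%classic s).
set x'' := cx (_ s); set y'' := cy (_ s) => dy dx.
have unit : x' ^+ 2 + y' ^+ 2 = 1 by exact: arclength_unit.
have orth : x' * x'' + y' * y'' = 0.
  have := is_derive_locally_cst oI Is (fun t => @arclength_unit t)
    (is_deriveD (is_deriveM dx dx) (is_deriveM dy dy)).
  rewrite -![_ *: _]/(_ * _) -/(cx _) -/(cy _) -/x' -/y'.
  move=> h; have {}h : (x' * x'' + y' * y'') *+ 2 = 0 by rewrite -h; ring.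
  by move: h => /eqP; rewrite mulrn_eq0 => /eqP.
split.
(* Written this way, [unit] reduces the first term to the acceleration component and [orth] kills
   the second. *)
- have -> : - ((x' * y'' - y' * x'') * y') =
      x'' * (x' ^+ 2 + y' ^+ 2) - x' * (x' * x'' + y' * y'') by ring.
  by rewrite unit orth mulr1 mulr0 subr0; exact: dx.
- have -> : (x' * y'' - y' * x'') * x' =
      y'' * (x' ^+ 2 + y' ^+ 2) - y' * (x' * x'' + y' * y'') by ring.
  by rewrite unit orth mulr1 mulr0 subr0; exact: dy.
Qed.

End unit_speed.

(** * Affine maps and Heisenberg rigid motions *)

Definition affine3 (u1 u2 u3 b p : 'rV[R]_3) : 'rV[R]_3 :=
  cx p *: u1 + cy p *: u2 + cz p *: u3 + b.

Lemma is_diff_affine3 (u1 u2 u3 b p : 'rV[R]_3) :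
  is_diff p (affine3 u1 u2 u3 b) (affine3 u1 u2 u3 0).
Proof.
have dc (c : {linear 'rV[R]_3 -> R}) (u : 'rV[R]_3) : continuous c ->
    is_diff p (fun q => c q *: u) (fun q => c q *: u).
  move=> cc; have dcp : differentiable c p by exact: linear_differentiable.
  apply: DiffDef; first exact: differentiableZl.
  by rewrite diffZl//; apply/funext => q; rewrite diff_lin.
have dx := dc (@cx R) u1 (@coord_continuous _ _ _ _ _).
have dy := dc (@cy R) u2 (@coord_continuous _ _ _ _ _).
have dz := dc (@cz R) u3 (@coord_continuous _ _ _ _ _).
exact: (is_diffD (is_diffD (is_diffD dx dy) dz) (is_diff_cst b p)).
Qed.

(** Each directional derivative is constant in the base point, so smoothness reduces to that of
    constants. *)
Lemma smooth_affine3 (u1 u2 u3 b : 'rV[R]_3) :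
  smooth_on setT (affine3 u1 u2 u3 b).
Proof.
case=> [p _|n v].
  by apply: differentiable_continuous; have [] := is_diff_affine3 u1 u2 u3 b p.
split=> [p _|].
  by apply: diff_derivable; have [] := is_diff_affine3 u1 u2 u3 b p.
apply: Cn_on_ext openT _ (@Cn_on_cst _ _ _ _ n (affine3 u1 u2 u3 0 v)) => p _.
have [df dfE] := is_diff_affine3 u1 u2 u3 b p.
by rewrite deriveE// dfE.
Qed.

(* The rotation of angle [t] about the z-axis, with [c = cos t] and
   [s = sin t], followed by the left translation by [(a, b, d)]. *)
Definition rigid (c s a b d : R) : 'rV[R]_3 -> 'rV[R]_3 :=
  affine3 (vec3 c s (b * c - a * s)) (vec3 (- s) c (- b * s - a * c))
          (vec3 0 0 1) (vec3 a b d).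

Lemma rigidE (c s a b d : R) (p : 'rV[R]_3) :
  rigid c s a b d p =
  vec3 (a + (c * cx p - s * cy p)) (b + (s * cx p + c * cy p))
       (d + cz p + b * (c * cx p - s * cy p) - a * (s * cx p + c * cy p)).
Proof.
rewrite /rigid /affine3.
by apply: coordP; rewrite !coordE; ring.
Qed.

Lemma diff_rigid (c s a b d : R) (p v : 'rV[R]_3) :
  'd (rigid c s a b d) p v =
  vec3 (c * cx v - s * cy v) (s * cx v + c * cy v)
       (cz v + b * (c * cx v - s * cy v) - a * (s * cx v + c * cy v)).
Proof.
have [_ ->] := is_diff_affine3 (vec3 c s (b * c - a * s))
  (vec3 (- s) c (- b * s - a * c)) (vec3 0 0 1) (vec3 a b d) p.
rewrite /affine3 addr0.
by apply: coordP; rewrite !coordE; ring.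
Qed.

(** Left translations preserve the left invariant frame, and rotations about the z-axis preserve
    both the contact form and [J0]. In coordinates these become polynomial identities modulo
    [c2]. *)
Lemma rigid_PSH (c s a b d : R) : c ^+ 2 + s ^+ 2 = 1 -> PSH (rigid c s a b d).
Proof.
move=> cs1; have c2 : c ^+ 2 = 1 - s ^+ 2 by rewrite -cs1 addrK.
split.
- split; first exact: smooth_affine3.
  (* Inverse: rotate by the opposite angle, then translate by the group inverse [(-a, -b, -d)]
     rotated back. *)
  exists (rigid c (- s) (- (c * a + s * b)) (s * a - c * b) (- d)).
  split; first exact: smooth_affine3.
  + by move=> p; rewrite !rigidE !cE; apply: coordP; rewrite !cE; ring: c2.
  + by move=> p; rewrite !rigidE !cE; apply: coordP; rewrite !cE; ring: c2.
- move=> p v; rewrite diff_rigid rigidE /theta0 !cE.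
  by ring: c2.
- move=> p v _; rewrite !diff_rigid rigidE /J0 /e1 /e2.
  by apply: coordP; rewrite !coordE;
    ring: c2.
Qed.

(** * Uniqueness up to a rigid motion *)

Lemma is_derive_cz I gamma s : smooth_on I gamma -> I s ->
  is_derive s 1 (fun t => cz (gamma t))
    (Tvariation gamma s - cx (gamma s) * cy (gamma^`()%classic s)
                        + cy (gamma s) * cx (gamma^`()%classic s)).
Proof.
move=> gs Is; have [_ _] := is_derive_curve gs Is.
by rewrite /Tvariation metric_eT /theta0 addrAC subrK addrK.
Qed.

Lemma curve_uniqueness I gamma1 gamma2 : open I -> is_interval I -> I !=set0 ->
  smooth_on I gamma1 -> smooth_on I gamma2 ->
  horizontal_arclength I gamma1 -> horizontal_arclength I gamma2 ->
  (forall s, I s -> pcurvature gamma1 s = pcurvature gamma2 s) ->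
  (forall s, I s -> Tvariation gamma1 s = Tvariation gamma2 s) ->
  exists2 g, PSH g & forall s, I s -> gamma2 s = g (gamma1 s).
Proof.
move=> oI Iitv [s0 Is0] gs1 gs2 arc1 arc2 kE tauE.
(* Each parameter of the rigid motion will be a function with zero derivative, evaluated at [s0]. *)
have cst_on (f : R -> R) (f' : R -> R) :
    (forall t, I t -> is_derive t 1 f (f' t)) -> (forall t, I t -> f' t = 0) ->
    forall t, I t -> f t = f s0.
  move=> df f'0 t It; apply: (is_derive_eq0_itv Iitv) => // x Ix.
  by rewrite -(f'0 x Ix); exact: df.
pose x1' t := cx (gamma1^`()%classic t); pose y1' t := cy (gamma1^`()%classic t).
pose x2' t := cx (gamma2^`()%classic t); pose y2' t := cy (gamma2^`()%classic t).
have unit1 t : I t -> x1' t ^+ 2 + y1' t ^+ 2 = 1 by exact: arclength_unit.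
have unit2 t : I t -> x2' t ^+ 2 + y2' t ^+ 2 = 1 by exact: arclength_unit.
have dv1 t (It : I t) := is_derive_velocity oI gs1 arc1 It.
have dv2 t (It : I t) := is_derive_velocity oI gs2 arc2 It.
(* Cosine and sine of the angle from the first projected velocity to the second. The angle stays
   constant because both velocities turn at the same rate [k]. *)
pose c := x1' s0 * x2' s0 + y1' s0 * y2' s0.
pose s := x1' s0 * y2' s0 - y1' s0 * x2' s0.
have cE t : I t -> x1' t * x2' t + y1' t * y2' t = c.
  move: t; apply: cst_on => t It.
    have [dx1 dy1] := dv1 t It; have [dx2 dy2] := dv2 t It.
    exact: (is_deriveD (is_deriveM dx1 dx2) (is_deriveM dy1 dy2)).
  by cbv beta; rewrite -![_ *: _]/(_ * _) (kE t It); ring.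
have sE t : I t -> x1' t * y2' t - y1' t * x2' t = s.
  move: t; apply: cst_on => t It.
    have [dx1 dy1] := dv1 t It; have [dx2 dy2] := dv2 t It.
    exact: (is_deriveB (is_deriveM dx1 dy2) (is_deriveM dy1 dx2)).
  by cbv beta; rewrite -![_ *: _]/(_ * _) (kE t It); ring.
have x2E t : I t -> x2' t = c * x1' t - s * y1' t.
  move=> It; rewrite -(cE t It) -(sE t It).
  by rewrite -[LHS]mulr1 -(unit1 t It); ring.
have y2E t : I t -> y2' t = s * x1' t + c * y1' t.
  move=> It; rewrite -(cE t It) -(sE t It).
  by rewrite -[LHS]mulr1 -(unit1 t It); ring.
(* Lagrange's identity: the sum is the product of the two squared speeds. *)
have cs1 : c ^+ 2 + s ^+ 2 = 1.
  rewrite -[RHS]mulr1 -[in X in X * _](unit1 _ Is0) -(unit2 _ Is0) /c /s.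
  by ring.
pose X t := c * cx (gamma1 t) - s * cy (gamma1 t).
pose Y t := s * cx (gamma1 t) + c * cy (gamma1 t).
have dX t : I t -> is_derive t 1 X (x2' t).
  move=> It; have [dx dy _] := is_derive_curve gs1 It; rewrite x2E//.
  exact: (is_deriveB (is_deriveZ c dx) (is_deriveZ s dy)).
have dY t : I t -> is_derive t 1 Y (y2' t).
  move=> It; have [dx dy _] := is_derive_curve gs1 It; rewrite y2E//.
  exact: (is_deriveD (is_deriveZ s dx) (is_deriveZ c dy)).
pose a := cx (gamma2 s0) - X s0; pose b := cy (gamma2 s0) - Y s0.
have aE t : I t -> cx (gamma2 t) - X t = a.
  move: t; apply: cst_on => t It.
    by have [dx _ _] := is_derive_curve gs2 It; exact: is_deriveB dx (dX t It).
  by rewrite /= subrr.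
have bE t : I t -> cy (gamma2 t) - Y t = b.
  move: t; apply: cst_on => t It.
    by have [_ dy _] := is_derive_curve gs2 It; exact: is_deriveB dy (dY t It).
  by rewrite /= subrr.
(* The vertical translation parameter obtained by solving the z-component of [rigidE] at time [t];
   it must be shown constant. *)
pose Z (t : R) := (cz (gamma2 t) - cz (gamma1 t)) - (b * X t - a * Y t).
have ZE t : I t -> Z t = Z s0.
  move: t; apply: cst_on => t It.
    have dz1 := is_derive_cz gs1 It; have dz2 := is_derive_cz gs2 It.
    exact: (is_deriveB (is_deriveB dz2 dz1)
      (is_deriveB (is_deriveZ b (dX t It)) (is_deriveZ a (dY t It)))).
  cbv beta; rewrite -![_ *: _]/(_ * _) (tauE t It).
  rewrite -(aE t It) -(bE t It) -/(x1' t) -/(x2' t) -/(y1' t) -/(y2' t).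
  (* Once the T-variations cancel and [a], [b] are expanded, what is left is that the area form of
     position and velocity is invariant under rotation. Rotating the second velocity back makes it a
     ring identity. *)
  have -> : x1' t = c * x2' t + s * y2' t.
    by rewrite x2E// y2E// -[LHS]mul1r -cs1; ring.
  have -> : y1' t = c * y2' t - s * x2' t.
    by rewrite x2E// y2E// -[LHS]mul1r -cs1; ring.
  by rewrite /X /Y; ring.
exists (rigid c s a b (Z s0)); first exact: rigid_PSH.
move=> t It; rewrite rigidE -/(X t) -/(Y t) -{1}(aE t It) -{1}(bE t It).
by rewrite -(ZE t It) /Z; apply: coordP; rewrite !Defs.cE; ring.
Qed.

(** * Existence by successive integration *)

Lemma curve_existence I (k tau : R -> R) : open I -> is_interval I ->
  I !=set0 -> smooth_on I k -> smooth_on I tau ->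
  exists gamma, [/\ smooth_on I gamma, horizontal_arclength I gamma,
    forall s, I s -> pcurvature gamma s = k s &
    forall s, I s -> Tvariation gamma s = tau s].
Proof.
move=> oI Iitv [s0 Is0] ks taus.
have prim f : smooth_on I f ->
    forall t, I t -> is_derive t 1 (primitive s0 f) (f t).
  by move=> fs; apply: is_derive_primitive => // t; exact: (fs 0%N).
have prims f : smooth_on I f -> smooth_on I (primitive s0 f).
  by move=> fs; exact: smooth_primitive (prim f fs) fs.
pose theta := primitive s0 k; have dtheta := prim k ks.
have [cs ss] := smooth_trigo oI (prims k ks).
pose x := primitive s0 (fun t => cos (theta t)).
pose y := primitive s0 (fun t => sin (theta t)).
(* The value of z' obtained by solving [tau = z' + x y' - y x'] with [x' = cos theta] and
   [y' = sin theta]. *)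
pose w t := tau t + y t * cos (theta t) - x t * sin (theta t).
have ws : smooth_on I w.
  by move=> n; do ?[exact: ss|exact: cs|exact: taus|exact: prims
    |apply: Cn_onD|apply: Cn_onM|apply: Cn_onN].
pose gamma t := vec3 (x t) (y t) (primitive s0 w t).
have dgamma t : I t -> is_derive t 1 gamma (vec3 (cos (theta t)) (sin (theta t)) (w t)).
  by move=> It; apply: is_derive_vec3; exact: prim.
have g'E t : I t -> gamma^`()%classic t = vec3 (cos (theta t)) (sin (theta t)) (w t).
  by move=> It; rewrite derive1E; have [_ ->] := dgamma t It.
have gs : smooth_on I gamma by apply: smooth_vec3 => //; exact: prims.
exists gamma; split=> // t It.
- by rewrite mnorm_hpart g'E// !cE cos2Dsin2 sqrtr1.
- rewrite (pcurvatureE gs It).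
  have dcos := is_derive1_comp (is_derive_cos (theta t)) (dtheta t It).
  have dsin := is_derive1_comp (is_derive_sin (theta t)) (dtheta t It).
  have dw := smooth_derivable ws It.
  (* The formula for the velocity holds only on [I], so it is differentiated through its germ at
     [t]. The derivative of [w] stays abstract, since the p-curvature involves planar components
     only. *)
  have [_ D] : is_derive t 1 gamma^`()%classic
      (vec3 (- sin (theta t) * k t) (cos (theta t) * k t) (w^`()%classic t)).
    apply: near_eq_is_derive (is_derive_vec3 dcos dsin _).
      by apply: filterS (open_nbhs_nbhs (conj oI It)) => u /g'E ->.
    by rewrite derive1E; exact: derivableP.
  rewrite [gamma^`()^`()%classic t]derive1E D g'E// !cE.
  rewrite -[RHS]mul1r -(cos2Dsin2 (theta t)); ring.
- rewrite /Tvariation metric_eT g'E// /theta0 /gamma !cE /w; ring.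
Qed.

End heisenberg.

Theorem theorem1p2 (R : realType) (I : set R) (Iopen : open I)
    (Iitv : is_interval I) (Ine : I !=set0) :
  (forall gamma1 gamma2 : R -> 'rV[R]_3,
     smooth_on I gamma1 -> smooth_on I gamma2 ->
     horizontally_regular I gamma1 -> horizontally_regular I gamma2 ->
     horizontal_arclength I gamma1 -> horizontal_arclength I gamma2 ->
     (forall s, I s -> pcurvature gamma1 s = pcurvature gamma2 s) ->
     (forall s, I s -> Tvariation gamma1 s = Tvariation gamma2 s) ->
     exists g : 'rV[R]_3 -> 'rV[R]_3,
       PSH g /\ forall s, I s -> gamma2 s = g (gamma1 s))
  /\
  (forall k tau : R -> R,
     smooth_on I k -> smooth_on I tau ->
     exists gamma : R -> 'rV[R]_3,
       [/\ smooth_on I gamma,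
           horizontally_regular I gamma,
           horizontal_arclength I gamma,
           forall s, I s -> pcurvature gamma s = k s &
           forall s, I s -> Tvariation gamma s = tau s]).
Proof.
(* A vanishing horizontal velocity would have norm 0 instead of 1. *)
have regular gamma : horizontal_arclength I gamma ->
    horizontally_regular I gamma.
  move=> arc s /arc sp1; apply: contraTneq isT => hv0; move: sp1.
  rewrite hv0 /mnorm /metric /theta0 /cx /cy /cz !mxE.
  rewrite !(mulr0, addr0, subr0) sqrtr0 => /esym/eqP.
  by rewrite oner_eq0.
split=> [gamma1 gamma2 gs1 gs2 _ _ arc1 arc2 kE tauE|k tau ks taus].
  have [g Pg gE] := curve_uniqueness Iopen Iitv Ine gs1 gs2 arc1 arc2 kE tauE.
  by exists g.
have [gamma [gs arc kE tauE]] := curve_existence Iopen Iitv Ine ks taus.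
by exists gamma; split=> //; exact: regular.
Qed.
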